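(* Let $\mathcal{A}\in\mathbb{C}^{m\times n\times r}$, $\mathcal{B}\in\mathbb{C}^{h\times k\times r}$, $\mathcal{C}\in\mathbb{C}^{a\times b\times r}$, $\mathcal{D}\in\mathbb{C}^{l\times d\times r}$ be given tensors with $m\neq h$. If there exists a solution $X\in\mathbb{C}^p$ to the system $\mathcal{A}\ltimes X=\mathcal{B}$, $X\ltimes\mathcal{C}=\mathcal{D}$, then $\mathcal{B}$ has the block form $$\mathcal{B}=\begin{bmatrix}\operatorname{Block}_1(\mathcal{B})\\ \vdots\\ \operatorname{Block}_m(\mathcal{B})\end{bmatrix},\qquad \operatorname{Block}_s(\mathcal{B})=\begin{bmatrix}\operatorname{Row}_{\frac{(s-1)h}{m}+1}(\mathcal{B})\\ \vdots\\ \operatorname{Row}_{\frac{sh}{m}}(\mathcal{B})\end{bmatrix},$$ where each $\operatorname{Block}_s(\mathcal{B})$, $s=1,\dots,m$, is a Toeplitz tensor. Moreover, there are scalars $\alpha_1,\dots,\alpha_p\in\mathbb{C}$ such that the entries of $\mathcal{D}$ satisfy $d_{t+(g-1)a,\,j,\,i}=\alpha_g\,c_{t,j,i}$ for $t=1,\dots,a$, $g=1,\dots,p$, $j=1,\dots,b$, $i=1,\dots,r$; here the entries $d_{t+(g-1)a,j,i}$ form the sub-tensor $\mathcal{D}_g\in\mathbb{C}^{a\times b\times r}$ of $\mathcal{D}$.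
   Context: Tensors are third-order arrays over $\mathbb{C}$, with all dimensions positive integers; $c_{t,j,i}$ and $d_{t,j,i}$ are the entries of $\mathcal{C}$ and $\mathcal{D}$. A vector in $\mathbb{C}^p$ is regarded as a $p\times 1\times 1$ tensor. An equality of tensors means that both the sizes and all entries agree. $\operatorname{Row}_u(\mathcal{B})$ is the $u$-th horizontal slice of $\mathcal{B}$ (first index fixed equal to $u$), viewed as a $1\times k\times r$ tensor. A third-order tensor is a Toeplitz tensor if every frontal slice (third index fixed) is a Toeplitz matrix, i.e. its entries $a_{i_1,i_2,i_3}$ depend only on $i_1-i_2$ and $i_3$. $[x,y]$ denotes the least common multiple. $I_{n\times n\times k}$ is the identity tensor: its first frontal slice is the $n\times n$ identity matrix and its other frontal slices are zero. The Kronecker product of $\mathcal{A}\in\mathbb{C}^{n_1\times n_2\times n_3}$ and $\mathcal{B}\in\mathbb{C}^{p_1\times p_2\times p_3}$ is the $n_1p_1\times n_2p_2\times n_3p_3$ tensor whose entry at position $((i_1-1)p_1+j_1,(i_2-1)p_2+j_2,(i_3-1)p_3+j_3)$ is $a_{i_1i_2i_3}b_{j_1j_2j_3}$. The t-product of $\mathcal{A}\in\mathbb{C}^{m\times n\times r}$ and $\mathcal{B}\in\mathbb{C}^{n\times s\times r}$ is $\mathcal{A}*\mathcal{B}\in\mathbb{C}^{m\times s\times r}$ whose $k$-th frontal slice is $\sum_{i+j\equiv k+1\ (\mathrm{mod}\ r)}\mathcal{A}_{(::i)}\mathcal{B}_{(::j)}$ (sum over $1\le i,j\le r$). The semi-tensor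 product of $\mathcal{A}\in\mathbb{C}^{m\times n\times r}$ and $\mathcal{B}\in\mathbb{C}^{p\times q\times s}$ is $\mathcal{A}\ltimes\mathcal{B}=(\mathcal{A}\otimes I_{\frac{t}{n}\times\frac{t}{n}\times\frac{e}{r}})*(\mathcal{B}\otimes I_{\frac{t}{p}\times\frac{t}{p}\times\frac{e}{s}})\in\mathbb{C}^{\frac{mt}{n}\times\frac{qt}{p}\times e}$, where $t=[n,p]$ and $e=[r,s]$. (Existence of a solution forces $m\mid h$, $l=pa$ and $b=d$, so the blocks above make sense.) *)

(* Defs.v *)
From HB Require Import structures.
From mathcomp Require Import all_boot all_order all_algebra.
From mathcomp Require Import reals complex mxtens.

Set Implicit Arguments.
Unset Strict Implicit.
Unset Printing Implicit Defensive.

Import Order.TTheory GRing.Theory Num.Theory.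
Local Open Scope ring_scope.

(* An n1 x n2 x n3 tensor is the family of its n3 frontal slices, so the entry
   a_{i1,i2,i3} is [A i3 i1 i2].  All indices are 0-based. *)
Definition tensor (T : Type) (n1 n2 n3 : nat) : Type :=
  {ffun 'I_n3 -> 'M[T]_(n1, n2)}.

Definition tensor_eq (T : Type) n1 n2 n3 n1' n2' n3'
    (A : tensor T n1 n2 n3) (B : tensor T n1' n2' n3') : Prop :=
  [/\ n1 = n1', n2 = n2', n3 = n3' &
      forall (i : 'I_n1) (i' : 'I_n1') (j : 'I_n2) (j' : 'I_n2')
             (k : 'I_n3) (k' : 'I_n3'),
        i = i' :> nat -> j = j' :> nat -> k = k' :> nat ->
        A k i j = B k' i' j'].

Definition cast_tensor (T : Type) n1 n2 n3 n1' n2' n3'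
    (e1 : n1 = n1') (e2 : n2 = n2') (e3 : n3 = n3')
    (A : tensor T n1 n2 n3) : tensor T n1' n2' n3' :=
  [ffun k => castmx (e1, e2) (A (cast_ord (esym e3) k))].

Definition vec_tensor (T : Type) p (X : 'cV[T]_p) : tensor T p 1 1 :=
  [ffun => X].

Section TensorProducts.
Variable K : comNzRingType.

Definition id_tensor n k : tensor K n n k :=
  [ffun i : 'I_k => if i == 0 :> nat then 1%:M else 0].

(* Both [tensmx] and [mxtens_unindex] use the lexicographic indexing
   (i, j) |-> i * p + j. *)
Definition kron_tensor n1 n2 n3 p1 p2 p3
    (A : tensor K n1 n2 n3) (B : tensor K p1 p2 p3) :
    tensor K (n1 * p1) (n2 * p2) (n3 * p3) :=
  [ffun k => tensmx (A (mxtens_unindex k).1) (B (mxtens_unindex k).2)].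

(* The 1-based condition i + j = k + 1 (mod r) becomes i + j = k (mod r). *)
Definition t_prod m n s r (A : tensor K m n r) (B : tensor K n s r) :
    tensor K m s r :=
  [ffun k : 'I_r =>
    \sum_(i < r) \sum_(j < r | (i + j == k %[mod r])%N) A i *m B j].

Lemma mul_lcml_div n p : (n * (lcmn n p %/ n) = lcmn n p)%N.
Proof. by rewrite mulnC divnK ?dvdn_lcml. Qed.

Lemma mul_lcmr_div n p : (p * (lcmn n p %/ p) = lcmn n p)%N.
Proof. by rewrite mulnC divnK ?dvdn_lcmr. Qed.

Definition st_prod m n r p q s
    (A : tensor K m n r) (B : tensor K p q s) :
    tensor K (m * (lcmn n p %/ n)) (q * (lcmn n p %/ p)) (lcmn r s) :=
  t_prod
    (cast_tensor erefl (mul_lcml_div n p) (mul_lcml_div r s)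
       (kron_tensor A (id_tensor (lcmn n p %/ n) (lcmn r s %/ r))))
    (cast_tensor (mul_lcmr_div n p) erefl (mul_lcmr_div r s)
       (kron_tensor B (id_tensor (lcmn n p %/ p) (lcmn r s %/ s)))).

End TensorProducts.

Definition toeplitz_mx (T : Type) m n (A : 'M[T]_(m, n)) : Prop :=
  forall (i i' : 'I_m) (j j' : 'I_n),
    i%:Z - j%:Z = i'%:Z - j'%:Z -> A i j = A i' j'.

Definition toeplitz_tensor (T : Type) m n r (A : tensor T m n r) : Prop :=
  forall k : 'I_r, toeplitz_mx (A k).

Definition Row (T : Type) h k r (u : 'I_h) (B : tensor T h k r) :
    tensor T 1 k r :=
  [ffun i => row u (B i)].

Lemma block_row_subproof m h (s : 'I_m) (u : 'I_(h %/ m)) :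
  ((s * h) %/ m + u < h)%N.
Proof.
have m_gt0 : (0 < m)%N by case: m s u => [[]|].
apply: (@leq_trans ((s * h) %/ m + h %/ m)); first by rewrite ltn_add2l.
rewrite -(leq_pmul2r m_gt0) mulnDl.
apply: (@leq_trans (s * h + h)); first by rewrite leq_add ?leq_divM.
by rewrite -mulSnr mulnC leq_mul2l ltn_ord orbT.
Qed.

(* The 0-based form of rows (s-1)h/m + 1, ..., sh/m. *)
Definition block_row m h (s : 'I_m) (u : 'I_(h %/ m)) : 'I_h :=
  Ordinal (block_row_subproof s u).

Definition Block (T : Type) m h k r (B : tensor T h k r) (s : 'I_m) :
    tensor T (h %/ m) k r :=
  [ffun i => \matrix_(u < h %/ m) Row (block_row s u) B i].

Definition vstack (T : Type) m (h : 'I_m -> nat) k r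
    (Bs : forall s, tensor T (h s) k r) : tensor T (\sum_(s < m) h s) k r :=
  [ffun i => \mxcol_(s < m) Bs s i].

(* [mxtens_index (g, t)] is g * a + t, the 0-based form of t + (g-1)a. *)
Definition subtensor (T : Type) p a b r (D : tensor T (p * a) b r) (g : 'I_p) :
    tensor T a b r :=
  [ffun i => \matrix_(t < a, j < b) D i (mxtens_index (g, t)) j].

(* Main.v *)
(* Since X has a single frontal slice, its Kronecker product with the identity
   tensor vanishes outside slice 0, so both t-products reduce to slicewise
   matrix products.  With q = [n,p]/n and w = [n,p]/p, the entry (u, v) of the
   s-th block of A |x X in slice i is the sum of A_i(s, y) X(x) over the pairs
   (y, x) such that y q + u = x w + v: it depends only on u - v.
   On the other side, X |x C is the Kronecker product of X with C, so that
   alpha = X works. *)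
Require Import Defs.
From HB Require Import structures.
From mathcomp Require Import all_boot all_order all_algebra.
From mathcomp Require Import reals complex mxtens.
From mathcomp Require Import zify.

Set Implicit Arguments.
Unset Strict Implicit.
Unset Printing Implicit Defensive.

Import Order.TTheory GRing.Theory Num.Theory.
Local Open Scope ring_scope.

Section TensorProductEntries.
Variable K : comNzRingType.

Lemma cast_tensorE (T : Type) n1 n2 n3 n1' n2' n3'
    (e1 : n1 = n1') (e2 : n2 = n2') (e3 : n3 = n3')
    (A : tensor T n1 n2 n3) k i j :
  cast_tensor e1 e2 e3 A k i j =
    A (cast_ord (esym e3) k) (cast_ord (esym e1) i) (cast_ord (esym e2) j).
Proof. by rewrite /cast_tensor ffunE castmxE. Qed.

Lemma kron_idE n1 n2 n3 q e (A : tensor K n1 n2 n3) k i j :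
  kron_tensor A (id_tensor K q e) k i j =
    A (mxtens_unindex k).1 (mxtens_unindex i).1 (mxtens_unindex j).1 *
    (((mxtens_unindex k).2 == 0 :> nat) &&
       ((mxtens_unindex i).2 == (mxtens_unindex j).2))%:R.
Proof. by rewrite !ffunE mxE; case: ifP => _; rewrite mxE. Qed.

(** Only [j = z] can contribute, and then [i = k] modulo [r] forces [i = k] because both are below
    [r]. *)
Lemma t_prod_slice0r m n s r (A : tensor K m n r) (B : tensor K n s r)
    (z k : 'I_r) :
  z = 0%N :> nat -> (forall j : 'I_r, j != z -> B j = 0) ->
  t_prod A B k = A k *m B z.
Proof.
move=> z0 B0; rewrite ffunE (bigD1 k) //= [X in _ + X]big1 => [|i ik].
  rewrite addr0 (bigD1 z) ?z0 ?addn0 //= big1 ?addr0 // => j /andP[_ /B0->].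
  by rewrite mulmx0.
rewrite big1 // => j; have [->|/B0->] := eqVneq j z; last by rewrite mulmx0.
by rewrite z0 addn0 !modn_small // => /eqP/val_inj/eqP; rewrite (negPf ik).
Qed.

Lemma t_prod_slice0l m n s r (A : tensor K m n r) (B : tensor K n s r)
    (z k : 'I_r) :
  z = 0%N :> nat -> (forall i : 'I_r, i != z -> A i = 0) ->
  t_prod A B k = A z *m B k.
Proof.
move=> z0 A0; rewrite ffunE (bigD1 z) //= [X in _ + X]big1 => [|i /A0->].
  rewrite addr0 (bigD1 k) ?z0 //= big1 ?addr0 // => j /andP[].
  by rewrite add0n !modn_small // => /eqP/val_inj->; rewrite eqxx.
by rewrite big1 // => j _; rewrite mul0mx.
Qed.

Lemma big_mxtens_index m n (F : 'I_(m * n) -> K) :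
  \sum_z F z = \sum_(i < m) \sum_(j < n) F (mxtens_index (i, j)).
Proof.
rewrite pair_bigA (reindex (@mxtens_index m n)) /=.
  by apply: eq_bigr => -[].
by exists (@mxtens_unindex m n) => y _; rewrite ?mxtens_indexK ?mxtens_unindexK.
Qed.

(** The identity factor beside [A] ties the contracted index to the form y q + u, while the one
    beside [X] reads that same index as x w + v; the entry sums over the indices that have both
    forms. *)
Lemma st_prod_vecr m n r p (A : tensor K m n r) (X : 'cV[K]_p)
    (k : 'I_(lcmn r 1)) (k' : 'I_r) (i : 'I_m)
    (u : 'I_(lcmn n p %/ n)) (v : 'I_(1 * (lcmn n p %/ p))) :
  k = k' :> nat ->
  st_prod A (vec_tensor X) k (mxtens_index (i, u)) v =
    \sum_(y < n) \sum_(x < p |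
        (y * (lcmn n p %/ n) + u == x * (lcmn n p %/ p) + v)%N)
      A k' i y * X x 0.
Proof.
move=> kk'; have r_gt0 : (0 < r)%N by case: r k' {A k kk'} => [[]|].
have e_gt0 : (0 < lcmn r 1)%N by rewrite lcmn1.
(* As [X] has one slice, slice [j] of its Kronecker product carries slice [j] of the identity
   tensor, which is zero for [j] other than 0. *)
rewrite /st_prod (@t_prod_slice0r _ _ _ _ _ _ (Ordinal e_gt0)) // => [|j j0]; last first.
  apply/matrixP=> x y; rewrite cast_tensorE kron_idE mxE /=.
  have ->: (j %% (lcmn r 1 %/ 1))%N = j by rewrite divn1 modn_small.
  by have /negPf := j0; rewrite -val_eqE /= => ->; rewrite mulr0.
rewrite mxE (reindex (cast_ord (mul_lcml_div n p))) /=; last first.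
  exists (cast_ord (esym (mul_lcml_div n p))) => y _;
  by rewrite ?cast_ordK ?cast_ordKV.
rewrite big_mxtens_index; apply: eq_bigr => y _.
rewrite (bigD1 u) //= big1 ?addr0 => [|u' u'u]; last first.
  rewrite cast_tensorE kron_idE cast_ordK cast_ord_id !mxtens_indexK /=.
  by rewrite [u == u']eq_sym (negPf u'u) andbF mulr0 mul0r.
rewrite !cast_tensorE !kron_idE !cast_ordK !cast_ord_id !mxtens_indexK /=.
have r1 : (lcmn r 1 %/ r = 1)%N by rewrite lcmn1 divnn r_gt0.
have k0 : (k %% (lcmn r 1 %/ r))%N = 0%N by rewrite r1 modn1.
have Ek :
    Ordinal (mxtens_index_proof1 (cast_ord (esym (mul_lcml_div r 1)) k)) = k'.
  by apply: val_inj; rewrite /= r1 divn1.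
rewrite k0 mod0n !eqxx Ek mulr1 /= ffunE (ord1 (Ordinal _)).
(* Dividing the contracted index [z] by [w] gives the row [x0] of [X] as quotient and the row of the
   identity factor as remainder. *)
set x0 : 'I_p := Ordinal _; rewrite -val_eqE /=.
set z := (y * _ + u)%N; set w := (lcmn n p %/ p)%N.
have vw : (v < w)%N by rewrite (leq_trans (ltn_ord v)) ?mul1n.
have zE : z = (x0 * w + z %% w)%N by exact: divn_eq.
(* Since [v < w], Euclidean division is unique: the inner sum has at most the term [x0], present
   exactly when the remainder is [v]. *)
have condE (x : 'I_p) : (z == x * w + v)%N = (x == x0) && (z %% w == v)%N.
  apply/eqP/andP => [zx|[/eqP-> /eqP <-]]; last exact: zE.
  rewrite -val_eqE /= -/z -/w zx divnMDl ?modnMDl ?(leq_ltn_trans _ vw) //.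
  by rewrite divn_small // modn_small // addn0 !eqxx.
rewrite (eq_bigl _ _ condE) (modn_small vw) {condE}.
case: (_ == _); last by rewrite big_pred0 ?mulr0 // => x; rewrite andbF.
by under eq_bigl do rewrite andbT; rewrite big_pred1_eq mulr1.
Qed.
(** Here the identity factor beside [C] is 1 x 1 x 1 and the one beside [X] is a x a in slice 0, so
    row (g, t) of the left factor has the single nonzero candidate [X g 0], in column [t]. *)
Lemma st_prod_vecl p a b r (X : 'cV[K]_p) (C : tensor K a b r)
    (k : 'I_(lcmn 1 r)) (k' : 'I_r) (g : 'I_p)
    (t : 'I_(lcmn 1 a %/ 1)) (t' : 'I_a)
    (j : 'I_(b * (lcmn 1 a %/ a))) (j' : 'I_b) :
  k = k' :> nat -> t = t' :> nat -> j = j' :> nat ->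
  st_prod (vec_tensor X) C k (mxtens_index (g, t)) j = X g 0 * C k' t' j'.
Proof.
move=> kk' tt' jj'; have r_gt0 : (0 < r)%N by apply: leq_ltn_trans (ltn_ord k').
have a_gt0 : (0 < a)%N by apply: leq_ltn_trans (ltn_ord t').
have e_gt0 : (0 < lcmn 1 r)%N by rewrite lcm1n.
have r1 : (lcmn 1 r %/ r = 1)%N by rewrite lcm1n divnn r_gt0.
have a1 : (lcmn 1 a %/ a = 1)%N by rewrite lcm1n divnn a_gt0.
rewrite /st_prod.
rewrite (@t_prod_slice0l _ _ _ _ _ _ (Ordinal e_gt0)) // => [|i i0]; last first.
  apply/matrixP=> x y; rewrite cast_tensorE kron_idE mxE /=.
  have ->: (i %% (lcmn 1 r %/ 1))%N = i by rewrite divn1 modn_small.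
  by have /negPf := i0; rewrite -val_eqE /= => ->; rewrite mulr0.
rewrite mxE (reindex (cast_ord (mul_lcml_div 1 a))) /=; last first.
  exists (cast_ord (esym (mul_lcml_div 1 a))) => y _;
  by rewrite ?cast_ordK ?cast_ordKV.
rewrite big_mxtens_index big_ord1 (bigD1 t) //= big1 ?addr0 => [|u ut]; last first.
  rewrite cast_tensorE kron_idE cast_ordK cast_ord_id !mxtens_indexK /=.
  by rewrite [t == u]eq_sym (negPf ut) andbF mulr0 mul0r.
rewrite !cast_tensorE !kron_idE !cast_ordK !cast_ord_id !mxtens_indexK /=.
have k0 : (k %% (lcmn 1 r %/ r))%N = 0%N by rewrite r1 modn1.
rewrite k0 mod0n !eqxx mulr1 /= ffunE -val_eqE /=.
have modn_a1 z : (z %% (lcmn 1 a %/ a) = 0)%N by rewrite a1 modn1.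
rewrite !modn_a1 eqxx mulr1.
have divn_a1 z : (z %/ (lcmn 1 a %/ a) = z)%N by rewrite a1 divn1.
by congr (X g _ * C _ _ _); apply: val_inj; rewrite /= ?r1 ?divn1 ?divn_a1.
Qed.

(** The condition y q + u = x w + v that selects the summands involves [u] and [v] only through
    their difference. *)
Lemma st_prod_vecr_toeplitz m n r p (A : tensor K m n r) (X : 'cV[K]_p)
    (k : 'I_(lcmn r 1)) (i : 'I_m) (u u' : 'I_(lcmn n p %/ n))
    (v v' : 'I_(1 * (lcmn n p %/ p))) :
  u%:Z - v%:Z = u'%:Z - v'%:Z ->
  st_prod A (vec_tensor X) k (mxtens_index (i, u)) v =
    st_prod A (vec_tensor X) k (mxtens_index (i, u')) v'.
Proof.
move=> uv; have kr : (k < r)%N by rewrite (leq_trans (ltn_ord k)) ?lcmn1.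
rewrite !(@st_prod_vecr _ _ _ _ _ _ _ (Ordinal kr)) //.
apply: eq_bigr => y _; apply: eq_bigl => x; apply/eqP/eqP; lia.
Qed.

End TensorProductEntries.

Lemma vstack_Block (T : Type) m h k r (B : tensor T h k r) :
  (m %| h)%N -> tensor_eq B (vstack (fun s : 'I_m => Block B s)).
Proof.
move=> mh; split=> // [|i i' j j' l l' ii' /val_inj <- /val_inj <-].
  by rewrite sum_nat_const card_ord mulnC divnK.
rewrite ffunE mxE ffunE mxE ffunE mxE; congr (B l _ j); apply: val_inj.
(* [tagnat.rect] writes a stacked row as the total height of the earlier blocks plus a local row;
   [m %| h] turns the offset of [block_row] into [s] times h/m, which is that height. *)
rewrite /= ii' tagnat.rect -muln_divA //; congr (_ + _)%N.
by rewrite (big_ord_narrow (ltnW (ltn_ord _))) sum_nat_const card_ord.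
Qed.

Theorem theorem3p5 (R : realType) (m n r h k a b l d p : nat)
  (m_gt0 : (0 < m)%N) (n_gt0 : (0 < n)%N) (r_gt0 : (0 < r)%N)
  (h_gt0 : (0 < h)%N) (k_gt0 : (0 < k)%N) (a_gt0 : (0 < a)%N)
  (b_gt0 : (0 < b)%N) (l_gt0 : (0 < l)%N) (d_gt0 : (0 < d)%N)
  (p_gt0 : (0 < p)%N)
  (A : tensor R[i] m n r) (B : tensor R[i] h k r)
  (C : tensor R[i] a b r) (D : tensor R[i] l d r)
  (neq_mh : m <> h)
  (solvable : exists X : 'cV[R[i]]_p,
     tensor_eq (st_prod A (vec_tensor X)) B /\
     tensor_eq (st_prod (vec_tensor X) C) D) :
  [/\ (m %| h)%N,
      tensor_eq B (vstack (fun s : 'I_m => Block B s)),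
      forall s : 'I_m, toeplitz_tensor (Block B s) &
      exists (el : l = (p * a)%N) (ed : d = b) (alpha : 'I_p -> R[i]),
        forall (t : 'I_a) (g : 'I_p) (j : 'I_b) (i : 'I_r),
          subtensor (cast_tensor el ed erefl D) g i t j = alpha g * C i t j].
Proof.
have [X [[eh ek er AX_B] [el ed _ XC_D]]] := solvable.
have mh : (m %| h)%N by rewrite -eh dvdn_mulr.
split=> //; first exact: vstack_Block.
- move=> s z u u' v v' uv.
  (* The size equation [eh] makes each block exactly q rows high, so row [u] of block [s] is row (s,
     u) of the product. *)
  have hq : (h %/ m = lcmn n p %/ n)%N by rewrite -eh mulKn.
  have Bblock (x : 'I_(h %/ m)) (y : 'I_k) : Block B s z x y =
      st_prod A (vec_tensor X) (cast_ord (esym er) z)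
        (mxtens_index (s, cast_ord hq x)) (cast_ord (esym ek) y).
    rewrite ffunE mxE ffunE mxE; symmetry; apply: AX_B => //=.
    by rewrite -muln_divA // -hq.
  by rewrite !Bblock; apply: st_prod_vecr_toeplitz.
(* With these values the size equations [el] and [ed] become l = p a and d = b, which the casts of
   [D] require. *)
have a1 : (lcmn 1 a %/ 1 = a)%N by rewrite divn1 lcm1n.
have b1 : (b * (lcmn 1 a %/ a) = b)%N by rewrite lcm1n divnn a_gt0 muln1.
have r1 : (lcmn 1 r = r)%N by rewrite lcm1n.
have el' : l = (p * a)%N by rewrite -el a1.
have ed' : d = b by rewrite -ed b1.
exists el', ed', (fun g => X g 0) => t g j i.
rewrite ffunE mxE cast_tensorE.
rewrite -(@st_prod_vecl _ _ _ _ _ X C (cast_ord (esym r1) i) i g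
            (cast_ord (esym a1) t) t (cast_ord (esym b1) j) j) //.
by symmetry; apply: XC_D => //=; rewrite a1.
Qed.
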